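(* Let $\gamma,\gamma_1\in \mathrm{SL}(2,\mathbb{C})$ be such that $\Sigma_\gamma=\mathrm{ISO}_\gamma$ and $\Sigma_{\gamma_1}=\mathrm{ISO}_{\gamma_1}$. Then $\{\overline{c(\gamma)},\, i\,\overline{c(\gamma)},\, j\}$ is a basis of eigenvectors of $A_\gamma$, $A_\gamma$ is the reflection in the plane $W_\gamma=\mathrm{span}_{\mathbb{R}}[\,i\,\overline{c(\gamma)},\,j\,]$, and $\overline{c(\gamma)}$ is orthogonal to $W_\gamma$. Moreover, the angle between $W_\gamma$ and $W_{\gamma_1}$ is given by $\arg\left(\frac{c(\gamma)}{c(\gamma_1)}\right)$.
   Context: $\mathbb{H}^3=\{z+rj : z\in\mathbb{C},\ r>0\}$ is the upper half space model of hyperbolic $3$-space, viewed inside $\mathbb{R}^3=\mathbb{C}\oplus\mathbb{R}j$, with hyperbolic distance $\rho$ and the usual action of $\mathrm{SL}(2,\mathbb{C})$ by orientation preserving isometries. For $\gamma=\begin{pmatrix}a&b\\ c&d\end{pmatrix}\in\mathrm{SL}(2,\mathbb{C})$ write $c(\gamma)=c$. If $\gamma(j)\neq j$, then $\Sigma_\gamma=\{P\in\mathbb{H}^3 : \rho(j,P)=\rho(P,\gamma^{-1}(j))\}$, $\sigma_\gamma$ is the hyperbolic reflection in $\Sigma_\gamma$, and $A_\gamma=\gamma\circ\sigma_\gamma$, so $\gamma=A_\gamma\circ\sigma_\gamma$. If $c\neq0$, $\mathrm{ISO}_\gamma=\{z+rj\in\mathbb{H}^3 : |cz+d|^2+|c|^2r^2=1\}$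 is the isometric sphere of $\gamma$, the hemisphere with center $-d/c$ and radius $1/|c|$. The hypothesis $\Sigma_\gamma=\mathrm{ISO}_\gamma$ includes that both objects are defined, i.e. $\gamma(j)\neq j$ and $c(\gamma)\neq0$. The assertion about $A_\gamma$ means that $A_\gamma$ is the restriction to $\mathbb{H}^3$ of a linear map of $\mathbb{R}^3$, also denoted $A_\gamma$, with the stated properties. The angle between the two planes, both of which contain the $j$-axis, is understood up to sign and modulo $\pi$. *)

(* Defs.v *)
From HB Require Import structures.
From mathcomp Require Import all_boot all_order all_algebra.
From mathcomp Require Import boolp classical_sets reals exp trigo.
From mathcomp Require Export complex.

Set Implicit Arguments.
Unset Strict Implicit.
Unset Printing Implicit Defensive.

Import Order.TTheory GRing.Theory Num.Theory.
Local Open Scope classical_set_scope.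
Local Open Scope ring_scope.
Local Open Scope complex_scope.

(* Squared modulus of a complex number, as an element of R. *)
Definition sqmod (R : realType) (z : R[i]) : R := complex.Re z ^+ 2 + complex.Im z ^+ 2.

(* C + Rj = R^3: the point z + rj has coordinates (Re z, Im z, r). *)
Definition zrj (R : realType) (z : R[i]) (r : R) : 'rV[R]_3 :=
  \row_(k < 3) [:: complex.Re z; complex.Im z; r]`_k.

Record H3 (R : realType) := MkH3 {
  h3z : R[i];
  h3r : R;
  h3r_gt0 : 0 < h3r
}.

Definition toR3 (R : realType) (P : H3 R) : 'rV[R]_3 := zrj (h3z P) (h3r P).

Definition jpt (R : realType) : H3 R := @MkH3 R 0 1 ltr01.

Definition dot (R : realType) (u v : 'rV[R]_3) : R := (u *m v^T) 0 0.

Definition arcosh (R : realType) (x : R) : R := ln (x + Num.sqrt (x ^+ 2 - 1)).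

(* cosh rho(P, Q) = 1 + |P - Q|^2 / (2 r s), with r, s the heights of P, Q. *)
Definition rho (R : realType) (P Q : H3 R) : R :=
  let w := toR3 P - toR3 Q in
  arcosh (1 + dot w w / (2 * h3r P * h3r Q)).

Record SL2 (R : realType) := MkSL2 {
  SL2mx :> 'M[R[i]]_2;
  SL2_det : \det SL2mx = 1
}.

Definition ca (R : realType) (g : SL2 R) : R[i] := g 0 0.
Definition cb (R : realType) (g : SL2 R) : R[i] := g 0 1.
Definition cc (R : realType) (g : SL2 R) : R[i] := g 1 0.
Definition cd (R : realType) (g : SL2 R) : R[i] := g 1 1.

Lemma SL2_inv_det (R : realType) (g : SL2 R) : \det (invmx g) = 1.
Proof. by rewrite det_inv SL2_det invr1. Qed.

Definition SL2inv (R : realType) (g : SL2 R) : SL2 R := MkSL2 (SL2_inv_det g).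

(* |cz + d|^2 + |c|^2 r^2 *)
Definition denom (R : realType) (g : SL2 R) (P : H3 R) : R :=
  sqmod (cc g * h3z P + cd g) + sqmod (cc g) * h3r P ^+ 2.

Lemma sqmod_ge0 (R : realType) (z : R[i]) : 0 <= sqmod z.
Proof. by rewrite addr_ge0 ?sqr_ge0. Qed.

Lemma sqmod_eq0 (R : realType) (z : R[i]) : (sqmod z == 0) = (z == 0).
Proof.
case: z => x y; rewrite /sqmod paddr_eq0 ?sqr_ge0 //= !sqrf_eq0.
by rewrite eq_complex.
Qed.

Lemma denom_gt0 (R : realType) (g : SL2 R) (P : H3 R) : 0 < denom g P.
Proof.
have r0 := h3r_gt0 P.
have ge0 : 0 <= sqmod (cc g) * h3r P ^+ 2
  by rewrite mulr_ge0 ?sqmod_ge0 ?sqr_ge0.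
rewrite lt0r /denom addr_ge0 ?sqmod_ge0 // andbT paddr_eq0 ?sqmod_ge0 //.
rewrite mulf_eq0 !sqmod_eq0 sqrf_eq0 (gt_eqF r0) orbF.
apply/negP => /andP[/eqP d0 /eqP c0]; move: (SL2_det g) d0.
rewrite c0 mul0r add0r => + d0.
rewrite (expand_det_row _ 1) !big_ord_recl big_ord0 /=.
have -> : g 1 ord0 = 0 by rewrite -c0.
have -> : g 1 (lift ord0 ord0) = 0.
  by rewrite -d0 /cd; congr (_ 1 _); apply/val_inj.
by rewrite !mul0r !addr0 => /eqP; rewrite eq_sym oner_eq0.
Qed.

(* The action (aP + b)(cP + d)^-1, computed in Hamilton's quaternions:
   z + rj is sent to
   ((az+b) conj(cz+d) + a conj(c) r^2 + rj) / (|cz+d|^2 + |c|^2 r^2). *)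
Definition act (R : realType) (g : SL2 R) (P : H3 R) : H3 R :=
  @MkH3 R
    (((ca g * h3z P + cb g) * conjc (cc g * h3z P + cd g)
      + ca g * conjc (cc g) * (h3r P ^+ 2)%:C) / (denom g P)%:C)
    (h3r P / denom g P)
    (divr_gt0 (h3r_gt0 P) (denom_gt0 g P)).

Definition Sigma (R : realType) (g : SL2 R) : set (H3 R) :=
  [set P | rho (jpt R) P = rho P (act (SL2inv g) (jpt R))].

Definition ISO (R : realType) (g : SL2 R) : set (H3 R) :=
  [set P | denom g P = 1].

Definition hyp_isometry (R : realType) (f : H3 R -> H3 R) : Prop :=
  bijective f /\ forall P Q, rho (f P) (f Q) = rho P Q.

(* For S a hyperbolic plane there is exactly one such f: the only other
   isometry fixing S pointwise is the identity. *)
Definition is_hyp_reflection (R : realType) (S : set (H3 R))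
    (f : H3 R -> H3 R) : Prop :=
  hyp_isometry f /\ [set P | f P = P] = S.

(* The junk value id is used only if S admits no reflection. *)
Definition hyp_reflection (R : realType) (S : set (H3 R)) : H3 R -> H3 R :=
  if pselect (exists f, is_hyp_reflection S f) is left e
  then projT1 (cid e) else id.

Definition sigma (R : realType) (g : SL2 R) : H3 R -> H3 R :=
  hyp_reflection (Sigma g).

Definition Amap (R : realType) (g : SL2 R) : H3 R -> H3 R := act g \o sigma g.

Definition orth (R : realType) (v : 'rV[R]_3) (W : {vspace 'rV[R]_3}) : Prop :=
  forall w, w \in W -> dot v w = 0.

Definition is_eigenvector (R : realType) (L : 'End('rV[R]_3))
    (v : 'rV[R]_3) : Prop :=
  v != 0 /\ exists a : R, v \in passmx.leigenspace L a.

Definition is_plane_reflection (R : realType) (W : {vspace 'rV[R]_3})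
    (L : 'End('rV[R]_3)) : Prop :=
  [/\ \dim W = 2, forall w, w \in W -> L w = w
    & forall v, orth v W -> L v = - v].

Definition cbar (R : realType) (g : SL2 R) : 'rV[R]_3 := zrj (conjc (cc g)) 0.

Definition icbar (R : realType) (g : SL2 R) : 'rV[R]_3 :=
  zrj ((0 +i* 1) * conjc (cc g)) 0.

Definition jvec (R : realType) : 'rV[R]_3 := zrj 0 1.

Definition Wplane (R : realType) (g : SL2 R) : {vspace 'rV[R]_3} :=
  <<[:: icbar g; jvec R]>>%VS.

Definition vangle (R : realType) (u v : 'rV[R]_3) : R :=
  acos (dot u v / (Num.sqrt (dot u u) * Num.sqrt (dot v v))).

(* Two intersecting planes have two angles phi and pi - phi, according to the
   choice of the normals. *)
Definition is_plane_angle (R : realType) (W W' : {vspace 'rV[R]_3})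
    (phi : R) : Prop :=
  exists n n' : 'rV[R]_3,
    [/\ n != 0, n' != 0, orth n W, orth n' W' & phi = vangle n n'].

Definition eq_angle (R : realType) (phi theta : R) : Prop :=
  exists k : int, phi = theta + k%:~R * pi \/ phi = - theta + k%:~R * pi.

(* theta is a determination of arg z. *)
Definition is_arg (R : realType) (z : R[i]) (theta : R) : Prop :=
  z = (Num.sqrt (sqmod z))%:C * (cos theta +i* sin theta).

Lemma is_arg_exists (R : realType) (z : R[i]) : exists theta, is_arg z theta.
Proof.
have [->|z0] := eqVneq z 0.
  by exists 0; rewrite /is_arg /sqmod /= expr0n addr0 sqrtr0 mul0r.
case: z z0 => x y z0; set s := Num.sqrt (sqmod (x +i* y)).
have s2 : s ^+ 2 = x ^+ 2 + y ^+ 2 by rewrite sqr_sqrtr ?sqmod_ge0.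
have s0 : 0 < s by rewrite sqrtr_gt0 lt0r sqmod_eq0 z0 sqmod_ge0.
have sn0 : s != 0 by rewrite gt_eqF.
have h : (x / s) ^+ 2 + (y / s) ^+ 2 = 1.
  by rewrite !expr_div_n -mulrDl -s2 divff // expf_neq0.
have hx : -1 <= x / s <= 1.
  rewrite -ler_norml -(expr_le1 (n := 2)) // real_normK ?num_real //.
  by rewrite -h lerDl sqr_ge0.
have hs : sin (acos (x / s)) = `|y / s|.
  by rewrite sin_acos // -h addrAC subrr add0r sqrtr_sqr.
have arg t : cos t = x / s -> sin t = y / s -> is_arg (x +i* y) t.
  move=> ct st; rewrite /is_arg -/s ct st; apply/eqP.
  by rewrite eq_complex /= !mul0r subr0 addr0 ![s * _]mulrC !divfK ?eqxx.
have [y0|y0] := leP 0 (y / s).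
  by exists (acos (x / s)); apply: arg; rewrite ?acosK // hs ger0_norm.
exists (- acos (x / s)); apply: arg; first by rewrite cosN acosK.
by rewrite sinN hs ltr0_norm // opprK.
Qed.

(* Main.v *)
From HB Require Import structures.
Require Import Defs.
From mathcomp Require Import all_boot all_order all_algebra.
From mathcomp Require Import boolp classical_sets reals exp trigo.
From mathcomp Require Import ring lra.
Import Order.TTheory GRing.Theory Num.Theory.
Set Implicit Arguments.
Unset Strict Implicit.
Unset Printing Implicit Defensive.

Local Open Scope ring_scope.
Local Open Scope complex_scope.

(** A hyperbolic isometry fixing exactly a hemisphere S moves P to a point that
    has the same distances as P to all points of S: this is P or its inverse in S.
    So sigma is the inversion in the isometric sphere, with center p = -d/c.
    That j and the inverse image of j under gamma are equidistant from that
    sphere forces the latter to lie on the ray from p through j, and this says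
    d = conj a.  Then gamma o sigma maps z + rj to -(conj c / c) conj z + rj, the
    Euclidean reflection along conj c.  Normals of the two planes are real
    multiples of conj c and conj c1, whence cos^2 phi = cos^2 arg (c / c1). *)

(** * Zeros of the sine and angles modulo pi *)

Lemma sin_natmul_pi (R : realType) (n : nat) : sin (n%:R * pi) = 0 :> R.
Proof.
elim: n => [|n IHn]; first by rewrite mul0r sin0.
by rewrite -natr1 mulrDl mul1r sinDpi IHn oppr0.
Qed.

Lemma sin_intmul_pi (R : realType) (m : int) : sin (m%:~R * pi) = 0 :> R.
Proof.
by case: m => n; rewrite ?NegzE ?mulrNz ?mulNr ?sinN sin_natmul_pi ?oppr0.
Qed.

(** Subtracting pi times the floor of x / pi moves x into [0, pi), where the sine is positive except
    at 0. *)
Lemma sin_eq0_intmul_pi (R : realType) (x : R) :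
  sin x = 0 -> exists m : int, x = m%:~R * pi.
Proof.
move=> sx; exists (Num.floor (x / pi)); set m := Num.floor _.
have pi0 := pi_gt0 R; have /andP[] := floor_itv (x / pi); rewrite -/m.
rewrite ler_pdivlMr // ltr_pdivrMr // intrD mulrDl mul1r => lo hi.
have y0 : sin (x - m%:~R * pi) = 0.
  by rewrite sinB sx mul0r sin_intmul_pi mulr0 subrr.
apply/eqP; rewrite -subr_eq0 eq_le subr_ge0 lo andbT leNgt.
apply/negP => y_gt0.
have : 0 < sin (x - m%:~R * pi) by apply: sin_gt0_pi; lra.
by rewrite y0 ltxx.
Qed.

(** The product sin (phi - theta) * sin (phi + theta) equals cos^2 theta - cos^2 phi; its two
    factors account for the two signs in [eq_angle]. *)
Lemma eq_angle_of_sqr_cos (R : realType) (phi theta : R) :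
  cos phi ^+ 2 = cos theta ^+ 2 -> eq_angle phi theta.
Proof.
move=> e.
have : sin (phi - theta) * sin (phi + theta) = 0.
  rewrite sinB sinD -subr_sqr !exprMn !sin2cos2 e; ring.
move/eqP; rewrite mulf_eq0 => /orP[]/eqP/sin_eq0_intmul_pi[m hm]; exists m.
  by left; rewrite -hm; ring.
by right; rewrite -hm; ring.
Qed.

(** * Coordinates on C + Rj *)

Lemma H3_eq (R : realType) (P Q : H3 R) : h3z P = h3z Q -> h3r P = h3r Q -> P = Q.
Proof.
case: P Q => [z r r0] [z' r' r'0] /= ez er; subst z' r'.
by rewrite (bool_irrelevance r0 r'0).
Qed.

Lemma dotE (R : realType) (u v : 'rV[R]_3) :
  dot u v = u 0 0 * v 0 0 + u 0 1 * v 0 1 + u 0 (inord 2) * v 0 (inord 2).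
Proof.
rewrite /dot mxE !big_ord_recl big_ord0 !mxE addr0 addrA.
by congr (_ * _ + _ * _ + _ * _); congr (_ _ _); apply/val_inj; rewrite //= inordK.
Qed.

Lemma zrjE (R : realType) (z : R[i]) (r : R) :
  (zrj z r 0 0 = complex.Re z) * (zrj z r 0 1 = complex.Im z)
  * (zrj z r 0 (inord 2) = r).
Proof. by rewrite !mxE /= inordK. Qed.

Lemma row3P (R : realType) (u v : 'rV[R]_3) :
  u 0 0 = v 0 0 -> u 0 1 = v 0 1 -> u 0 (inord 2) = v 0 (inord 2) -> u = v.
Proof.
move=> e0 e1 e2; apply/rowP => -[[|[|[|//]]] i].
- by rewrite (_ : Ordinal i = 0) //; apply/val_inj.
- by rewrite (_ : Ordinal i = 1) //; apply/val_inj.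
- by rewrite (_ : Ordinal i = inord 2) //; apply/val_inj; rewrite /= inordK.
Qed.

Lemma dot_zrj (R : realType) (z w : R[i]) (r s : R) :
  dot (zrj z r) (zrj w s) =
  complex.Re z * complex.Re w + complex.Im z * complex.Im w + r * s.
Proof. by rewrite dotE !zrjE. Qed.

Lemma ReB (R : realType) (z w : R[i]) :
  (complex.Re (z - w) = complex.Re z - complex.Re w)
  * (complex.Im (z - w) = complex.Im z - complex.Im w).
Proof. by case: z w => ? ? [? ?]. Qed.

Lemma ReD (R : realType) (z w : R[i]) :
  (complex.Re (z + w) = complex.Re z + complex.Re w)
  * (complex.Im (z + w) = complex.Im z + complex.Im w).
Proof. by case: z w => ? ? [? ?]. Qed.

Lemma ReZ (R : realType) (a : R) (z : R[i]) :
  (complex.Re (a%:C * z) = a * complex.Re z)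
  * (complex.Im (a%:C * z) = a * complex.Im z).
Proof. by case: z => ? ?; rewrite /= !mul0r subr0 addr0. Qed.

(** * Hyperbolic distance through a rational function *)

(* cosh rho = 1 + pseudo / 2 *)
Definition pseudo (R : realType) (P Q : H3 R) : R :=
  (sqmod (h3z P - h3z Q) + (h3r P - h3r Q) ^+ 2) / (h3r P * h3r Q).

Lemma pseudo_ge0 (R : realType) (P Q : H3 R) : 0 <= pseudo P Q.
Proof.
rewrite divr_ge0 ?addr_ge0 ?sqmod_ge0 ?sqr_ge0 //.
by rewrite mulr_ge0 ?ltW ?h3r_gt0.
Qed.

Lemma rho_pseudo (R : realType) (P Q : H3 R) :
  rho P Q = arcosh (1 + pseudo P Q / 2).
Proof.
rewrite /rho dotE /toR3 !(mxE, zrjE) /= inordK //=.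
congr (arcosh (1 + _)); rewrite /pseudo /sqmod !ReB.
have := h3r_gt0 P; have := h3r_gt0 Q => /lt0r_neq0 ? /lt0r_neq0 ?.
by field; apply/andP.
Qed.

Lemma arcosh_inj (R : realType) (x y : R) :
  1 <= x -> 1 <= y -> arcosh x = arcosh y -> x = y.
Proof.
have pos (t : R) : 1 <= t -> 0 < t + Num.sqrt (t ^+ 2 - 1).
  by move=> t1; rewrite ltr_wpDr ?sqrtr_ge0 // (lt_le_trans ltr01).
have mono (s t : R) : 1 <= s -> s < t -> arcosh s < arcosh t.
  move=> s1 st; rewrite ltr_ln ?posrE ?pos //; last exact: ltW (le_lt_trans s1 st).
  by rewrite ltr_leD // ler_wsqrtr // lerB // lerXn2r ?nnegrE //; lra.
move=> x1 y1 e; case: (ltgtP x y) => // lt.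
  by have := mono _ _ x1 lt; rewrite e ltxx.
by have := mono _ _ y1 lt; rewrite e ltxx.
Qed.

(** Since [pseudo] is nonnegative, [arcosh] is evaluated on [1, oo), where it is injective; from
    here on distances are compared by rational identities. *)
Lemma rho_eqE (R : realType) (P Q P' Q' : H3 R) :
  rho P Q = rho P' Q' <-> pseudo P Q = pseudo P' Q'.
Proof.
rewrite !rho_pseudo; split => [|-> //].
have := pseudo_ge0 P Q; have := pseudo_ge0 P' Q' => h h'.
by move=> e; have := arcosh_inj _ _ e; lra.
Qed.

(** * Inversions in hemispheres centred on the boundary *)

(** [k] is the squared radius, so that no square root enters the inversion. *)
Definition hemisphere (R : realType) (p : R[i]) (k : R) : set (H3 R) :=
  [set P | sqmod (h3z P - p) + h3r P ^+ 2 = k]%classic.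

Lemma power_gt0 (R : realType) (p : R[i]) (P : H3 R) :
  0 < sqmod (h3z P - p) + h3r P ^+ 2.
Proof. by rewrite ltr_wpDl ?sqmod_ge0 // exprn_gt0 ?h3r_gt0. Qed.

Lemma inversion_height_gt0 (R : realType) (p : R[i]) (k : R) (P : H3 R) :
  0 < k -> 0 < k / (sqmod (h3z P - p) + h3r P ^+ 2) * h3r P.
Proof. by move=> k0; rewrite mulr_gt0 ?divr_gt0 ?power_gt0 ?h3r_gt0. Qed.

(** [k0] is an argument because the image carries a proof that its height is positive. *)
Definition inversion (R : realType) (p : R[i]) (k : R) (k0 : 0 < k) (P : H3 R) :=
  MkH3 (p + (k / (sqmod (h3z P - p) + h3r P ^+ 2))%:C * (h3z P - p))
    (inversion_height_gt0 p P k0).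

Lemma Re_inversion (R : realType) (p : R[i]) (k : R) (k0 : 0 < k) (P : H3 R) :
  (complex.Re (h3z (inversion p k0 P)) = complex.Re p +
    k / (sqmod (h3z P - p) + h3r P ^+ 2) * (complex.Re (h3z P) - complex.Re p))
  * (complex.Im (h3z (inversion p k0 P)) = complex.Im p +
    k / (sqmod (h3z P - p) + h3r P ^+ 2) * (complex.Im (h3z P) - complex.Im p)).
Proof.
by split; rewrite [h3z (inversion _ _ _)]/= ReD ReZ ReB.
Qed.

Lemma h3r_inversion (R : realType) (p : R[i]) (k : R) (k0 : 0 < k) (P : H3 R) :
  h3r (inversion p k0 P) = k / (sqmod (h3z P - p) + h3r P ^+ 2) * h3r P.
Proof. by []. Qed.

Lemma eq_ReIm (R : realType) (z w : R[i]) :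
  complex.Re z = complex.Re w -> complex.Im z = complex.Im w -> z = w.
Proof. by case: z w => ? ? [? ?] /= -> ->. Qed.

Lemma inversion_power (R : realType) (p : R[i]) (k : R) (k0 : 0 < k) (P : H3 R) :
  sqmod (h3z (inversion p k0 P) - p) + h3r (inversion p k0 P) ^+ 2
  = k ^+ 2 / (sqmod (h3z P - p) + h3r P ^+ 2).
Proof.
have := power_gt0 p P; rewrite {2}/sqmod !ReB !Re_inversion h3r_inversion.
set D := sqmod _ + _ => D0.
have DE : D = (complex.Re (h3z P) - complex.Re p) ^+ 2
  + (complex.Im (h3z P) - complex.Im p) ^+ 2 + h3r P ^+ 2 by rewrite /D /sqmod !ReB.
(* P - p is scaled by k / D, hence its squared length D by (k / D)^2. *)
transitivity ((k / D) ^+ 2 * D); first by move: (k / D) => u; rewrite DE; ring.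
by field; rewrite gt_eqF.
Qed.

Lemma inversionK (R : realType) (p : R[i]) (k : R) (k0 : 0 < k) :
  involutive (inversion p k0).
Proof.
move=> P; have := inversion_power p k0 P.
have := power_gt0 p P; set D := sqmod _ + _ => D0 e.
apply: H3_eq; [apply: eq_ReIm|]; rewrite ?(Re_inversion, h3r_inversion) e.
- by rewrite -/D; field; rewrite !gt_eqF.
- by rewrite -/D; field; rewrite !gt_eqF.
- by rewrite -/D; field; rewrite !gt_eqF.
Qed.

(** Both |P - Q|^2 and the product of the heights are multiplied by k^2 / (|P - p|^2 |Q - p|^2),
    which cancels in the quotient. *)
Lemma inversion_pseudo (R : realType) (p : R[i]) (k : R) (k0 : 0 < k) (P Q : H3 R) :
  pseudo (inversion p k0 P) (inversion p k0 Q) = pseudo P Q.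
Proof.
have := power_gt0 p P; have := power_gt0 p Q.
have := h3r_gt0 P; have := h3r_gt0 Q => r0 s0 D0 E0.
rewrite /pseudo /sqmod !ReB !Re_inversion !h3r_inversion.
rewrite /sqmod !ReB in D0 E0 *.
field; rewrite !gt_eqF //.
Qed.

Lemma inversion_fixed (R : realType) (p : R[i]) (k : R) (k0 : 0 < k) (P : H3 R) :
  inversion p k0 P = P <-> hemisphere p k P.
Proof.
have D0 := power_gt0 p P; have r0 := h3r_gt0 P; split => [e|e].
  (* Equality of the heights alone forces the scaling factor to be 1. *)
  have /= := congr1 (@h3r R) e => /(canRL (mulfK _)).
  rewrite gt_eqF // divff ?gt_eqF // => /(_ isT)/divr1_eq.
  by rewrite /hemisphere /= => ->.
rewrite /hemisphere /= in e.
apply: H3_eq; [apply: eq_ReIm|]; rewrite ?(Re_inversion, h3r_inversion) e divff ?gt_eqF //.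
all: ring.
Qed.

Lemma inversion_is_reflection (R : realType) (p : R[i]) (k : R) (k0 : 0 < k) :
  is_hyp_reflection (hemisphere p k) (inversion p k0).
Proof.
split; first split.
- by apply: inv_bij; exact: inversionK.
- by move=> P Q; apply/rho_eqE; exact: inversion_pseudo.
- by apply/seteqP; split=> P h; apply/(inversion_fixed p k0 P).
Qed.

(** * Uniqueness of the reflection in a hemisphere *)

Lemma hemisphere_offset (R : realType) (p : R[i]) (k u v : R) :
  u ^+ 2 + v ^+ 2 < k ->
  exists2 S, hemisphere p k S & h3z S = p + (u +i* v).
Proof.
move=> lt; have t0 : 0 < Num.sqrt (k - (u ^+ 2 + v ^+ 2)) by rewrite sqrtr_gt0 subr_gt0.
exists (MkH3 (p + (u +i* v)) t0) => //.
rewrite /hemisphere /= [p + _]addrC addrK sqr_sqrtr ?subr_ge0 ?ltW // /sqmod /=; ring.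
Qed.

(* Multiplying the equality of pseudo-distances to a point of the hemisphere by
   the height of that point leaves an affine function of its projection to C,
   which vanishes on an open disc. *)
Lemma equidistant_hemisphere (R : realType) (p : R[i]) (k : R) (P Q : H3 R) :
  0 < k -> (forall S, hemisphere p k S -> pseudo P S = pseudo Q S) ->
  [/\ h3r Q * (sqmod (h3z P - p) + h3r P ^+ 2 + k)
       = h3r P * (sqmod (h3z Q - p) + h3r Q ^+ 2 + k),
      h3r Q * (complex.Re (h3z P) - complex.Re p)
       = h3r P * (complex.Re (h3z Q) - complex.Re p)
    & h3r Q * (complex.Im (h3z P) - complex.Im p)
       = h3r P * (complex.Im (h3z Q) - complex.Im p)].
Proof.
move=> k0 eqd; have r0 := h3r_gt0 P; have s0 := h3r_gt0 Q.
(* Half the radius: the offsets (e, 0) and (0, e) lie in the open disc below the hemisphere. *)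
pose e := Num.sqrt k / 2.
have e2 : e ^+ 2 = k / 4 by rewrite expr_div_n sqr_sqrtr ?ltW //; field.
have e0 : e != 0 by rewrite gt_eqF // divr_gt0 ?sqrtr_gt0.
(* For S in the hemisphere above p + (u, v), [F T u v] is the numerator of [pseudo T S + 2]; the
   equation of the hemisphere makes it affine in (u, v). *)
pose F (T : H3 R) u v := (sqmod (h3z T - p) + h3r T ^+ 2 + k)
  - 2 * (u * (complex.Re (h3z T) - complex.Re p)
         + v * (complex.Im (h3z T) - complex.Im p)).
have FE u v : u ^+ 2 + v ^+ 2 < k -> h3r Q * F P u v = h3r P * F Q u v.
  move=> lt; have [S hS zS] := hemisphere_offset p lt.
  have t0 := h3r_gt0 S.
  have tE : k = u ^+ 2 + v ^+ 2 + h3r S ^+ 2.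
    by move: hS; rewrite /hemisphere /= zS [p + _]addrC addrK => <-.
  have pE T : pseudo T S = F T u v / (h3r T * h3r S) - 2.
    have T0 := h3r_gt0 T.
    rewrite /pseudo zS /F tE /sqmod !(ReB, ReD) /=.
    by field; rewrite !gt_eqF.
  have := eqd S hS; rewrite !pE => /addIr /eqP.
  rewrite eqr_div ?mulf_neq0 ?lt0r_neq0 // => /eqP eF.
  apply: (mulIf (lt0r_neq0 t0)); move: (F P u v) (F Q u v) eF => a b eF; lra.
(* An affine function is determined by its values at three non-collinear points. *)
have F0 := FE 0 0; have Fu := FE e 0; have Fv := FE 0 e.
rewrite /F !expr0n !(mul0r, mulr0, addr0, add0r, subr0) e2 in F0 Fu Fv.
have {}F0 := F0 k0; have {}Fu : _ := Fu ltac:(lra); have {}Fv : _ := Fv ltac:(lra).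
split=> //; apply: (mulfI e0); lra.
Qed.

(** As f fixes every S of the hemisphere, P and f P are equidistant from S. Hence f P - p is a
    positive multiple of P - p, and the last relation leaves two values for the ratio. *)
Lemma reflection_hemisphere (R : realType) (p : R[i]) (k : R) (k0 : 0 < k)
    (f : H3 R -> H3 R) :
  is_hyp_reflection (hemisphere p k) f -> f =1 inversion p k0.
Proof.
move=> [[_ isof] fixf] P; have r0 := h3r_gt0 P; have D0 := power_gt0 p P.
have [S hS|] := @equidistant_hemisphere R p k P (f P) k0.
  have fS : f S = S by rewrite -fixf in hS.
  by apply/rho_eqE; rewrite -[in RHS]fS isof.
have s0 := h3r_gt0 (f P).
have DfE : sqmod (h3z (f P) - p) = (complex.Re (h3z (f P)) - complex.Re p) ^+ 2
    + (complex.Im (h3z (f P)) - complex.Im p) ^+ 2 by rewrite /sqmod !ReB.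
have DE : sqmod (h3z P - p) = (complex.Re (h3z P) - complex.Re p) ^+ 2
    + (complex.Im (h3z P) - complex.Im p) ^+ 2 by rewrite /sqmod !ReB.
move=> eD eRe eIm.
have xE : complex.Re (h3z (f P)) - complex.Re p
    = h3r (f P) / h3r P * (complex.Re (h3z P) - complex.Re p).
  by rewrite mulrAC eRe mulrAC divff ?mul1r // gt_eqF.
have yE : complex.Im (h3z (f P)) - complex.Im p
    = h3r (f P) / h3r P * (complex.Im (h3z P) - complex.Im p).
  by rewrite mulrAC eIm mulrAC divff ?mul1r // gt_eqF.
(* A quadratic equation for the ratio of the heights, with roots 1 and k / |P - p|^2. *)
have : (h3r P - h3r (f P))
    * (h3r (f P) * (sqmod (h3z P - p) + h3r P ^+ 2) - h3r P * k) = 0.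
  have := eD; rewrite DfE xE yE DE => /eqP; rewrite -subr_eq0 => /eqP {}eD.
  by rewrite -[RHS](mulr0 (h3r P)) -eD; field; rewrite gt_eqF.
move/eqP; rewrite mulf_eq0 => /orP[]/eqP/subr0_eq e.
  (* With ratio 1, P is fixed by f, so it lies on the hemisphere, where the inversion is the
     identity too. *)
  have fP : f P = P.
    rewrite -e divff ?gt_eqF // !mul1r in xE yE.
    by apply: H3_eq => //; apply: eq_ReIm; [move: xE|move: yE] => /addIr.
  by rewrite fP; apply/esym/inversion_fixed; rewrite -fixf.
have sE : h3r (f P) = k / (sqmod (h3z P - p) + h3r P ^+ 2) * h3r P.
  by apply: (mulIf (lt0r_neq0 D0)); rewrite e; field; rewrite gt_eqF.
apply: H3_eq; [apply: eq_ReIm|]; rewrite ?(Re_inversion, h3r_inversion) //.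
- by rewrite -[LHS](subrK (complex.Re p)) xE sE addrC; field; rewrite !gt_eqF.
- by rewrite -[LHS](subrK (complex.Im p)) yE sE addrC; field; rewrite !gt_eqF.
Qed.

(** The inversion shows that a reflection exists, which excludes the default value; uniqueness
    identifies the chosen one. *)
Lemma hyp_reflection_hemisphere (R : realType) (p : R[i]) (k : R) (k0 : 0 < k) :
  hyp_reflection (hemisphere p k) =1 inversion p k0.
Proof.
rewrite /hyp_reflection; case: pselect => [e|[]].
  by case: cid => f /= /reflection_hemisphere.
by exists (inversion p k0); exact: inversion_is_reflection.
Qed.

(** * Matrix entries, the isometric sphere and the formula for gamma o sigma *)

Lemma pseudoC (R : realType) (P Q : H3 R) : pseudo P Q = pseudo Q P.
Proof. by rewrite /pseudo /sqmod !ReB [h3r P * _]mulrC; congr (_ / _); ring. Qed.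

Lemma sqmodE (R : realType) (z : R[i]) : (sqmod z)%:C = z * conjc z.
Proof. by case: z => x y; apply: eq_ReIm; rewrite /sqmod /=; ring. Qed.

Lemma conjcM (R : realType) (z w : R[i]) : conjc (z * w) = conjc z * conjc w.
Proof. exact: rmorphM. Qed.

Lemma conjcD (R : realType) (z w : R[i]) : conjc (z + w) = conjc z + conjc w.
Proof. exact: rmorphD. Qed.

Lemma conjcN (R : realType) (z : R[i]) : conjc (- z) = - conjc z.
Proof. exact: rmorphN. Qed.

Lemma sqmodM (R : realType) (z w : R[i]) : sqmod (z * w) = sqmod z * sqmod w.
Proof. by case: z w => x y [u v]; rewrite /sqmod /=; ring. Qed.

Lemma sqmod_gt0 (R : realType) (z : R[i]) : (0 < sqmod z) = (z != 0).
Proof. by rewrite lt0r sqmod_ge0 sqmod_eq0 andbT. Qed.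

Lemma SL2_mxdet (R : realType) (g : SL2 R) : ca g * cd g - cb g * cc g = 1.
Proof.
have := SL2_det g; rewrite (expand_det_row _ 0) !big_ord_recl big_ord0 addr0.
rewrite /cofactor !det_mx11 !mxE /= expr0 expr1 mul1r mulN1r mulrN /ca /cb /cc /cd => <-.
by congr (_ * _ - _ * _); congr (_ _ _); apply/val_inj.
Qed.

(** The inverse of a matrix of determinant 1 is its adjugate. *)
Lemma SL2invE (R : realType) (g : SL2 R) :
  (ca (SL2inv g) = cd g) * (cb (SL2inv g) = - cb g)
  * (cc (SL2inv g) = - cc g) * (cd (SL2inv g) = ca g).
Proof.
rewrite /ca /cb /cc /cd /SL2inv /= /invmx unitmxE SL2_det unitr1 invr1 scale1r.
rewrite !mxE /cofactor !det_mx11 !mxE /= !expr0 expr1 !mulN1r expr2 mulN1r opprK !mul1r.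
by repeat split; do ?congr (- _); congr (_ _ _); apply/val_inj.
Qed.

Lemma denom_hemisphere (R : realType) (g : SL2 R) (P : H3 R) : cc g != 0 ->
  denom g P = sqmod (cc g) * (sqmod (h3z P - - (cd g / cc g)) + h3r P ^+ 2).
Proof.
move=> c0; rewrite /denom mulrDr -sqmodM opprK; congr (sqmod _ + _).
by rewrite mulrDr mulrCA divff ?mulr1.
Qed.

Lemma ISO_hemisphere (R : realType) (g : SL2 R) : cc g != 0 ->
  ISO g = hemisphere (- (cd g / cc g)) (sqmod (cc g))^-1.
Proof.
move=> c0; have n0 : sqmod (cc g) != 0 by rewrite sqmod_eq0.
apply/seteqP; split=> P; rewrite /ISO /hemisphere /= denom_hemisphere //.
  by move=> e; apply: (mulfI n0); rewrite e divff.
by move=> ->; rewrite divff.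
Qed.

Lemma Sigma_ISO_conjc (R : realType) (g : SL2 R) :
  cc g != 0 -> Sigma g = ISO g -> conjc (ca g) = cd g.
Proof.
move=> c0 hg; have k0 : 0 < (sqmod (cc g))^-1 by rewrite invr_gt0 sqmod_gt0.
have [S|_] := @equidistant_hemisphere R (- (cd g / cc g)) _ (jpt R)
  (act (SL2inv g) (jpt R)) k0.
  by rewrite -(ISO_hemisphere c0) -hg /Sigma /= rho_eqE pseudoC [RHS]pseudoC.
(* The two real relations combine into one complex relation: the height of the preimage of j, times
   0 - p, is the projection of that preimage to C minus p, where p = -d/c. *)
rewrite -!ReB /= !mul1r -!ReZ => eRe eIm.
have e := eq_ReIm eRe eIm; move: e; rewrite /denom !SL2invE /=.
rewrite !mulr0 !(add0r, expr1n, mulr1) /=.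
set N := sqmod _ + _.
have NE : N%:C = ca g * conjc (ca g) + cc g * conjc (cc g).
  by rewrite /N rmorphD /= !sqmodE rmorphN mulrNN.
have N0 : N%:C != 0.
  by rewrite fmorph_eq0 gt_eqF // ltr_wpDl ?sqmod_ge0 // sqmod_gt0 oppr_eq0.
rewrite fmorphV /= !opprK rmorphN /= => e.
(* Multiplication by N c clears the denominators: d = -(b conj a + d conj c) c + N d. *)
have : cd g - ((- cb g * conjc (ca g) + cd g * - conjc (cc g)) * cc g + N%:C * cd g)
    = (N%:C^-1 * (cd g / cc g) - ((- cb g * conjc (ca g) + cd g * - conjc (cc g)) / N%:C
        + cd g / cc g)) * (N%:C * cc g) by field; apply/andP.
rewrite e subrr mul0r NE => /eqP; rewrite subr_eq0 => /eqP {}e.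
(* As N = |a|^2 + |c|^2, the right-hand side collapses to (ad - bc) conj a. *)
apply/eqP; rewrite eq_sym -subr_eq0 -[conjc _]mul1r -(SL2_mxdet g) [X in X - _]e.
by apply/eqP; ring.
Qed.

(** At the inverted point the denominator of gamma is |c|^2 k^2 / D with k = 1 / |c|^2, that is k /
    D, the scaling factor of the inversion itself; so the heights cancel. *)
Lemma act_inversion (R : realType) (g : SL2 R) (k0 : 0 < (sqmod (cc g))^-1) (P : H3 R) :
  cc g != 0 -> conjc (ca g) = cd g ->
  h3z (act g (inversion (- (cd g / cc g)) k0 P))
    = - (conjc (cc g) / cc g) * conjc (h3z P) /\
  h3r (act g (inversion (- (cd g / cc g)) k0 P)) = h3r P.
Proof.
move=> c0 ad; have D0 := power_gt0 (- (cd g / cc g)) P.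
have n0 : sqmod (cc g) != 0 by rewrite sqmod_eq0.
have dQ := inversion_power (- (cd g / cc g)) k0 P.
have := denom_hemisphere (inversion (- (cd g / cc g)) k0 P) c0; rewrite dQ => dE.
split; last first.
  rewrite [LHS]/= dE; field; rewrite n0 gt_eqF //.
have cj0 : conjc (cc g) != 0 by rewrite conjc_eq0.
(* For the C-coordinate, b is eliminated by the determinant and r^2 by D, which leaves a rational
   identity for [field]. *)
have bE : cb g = (ca g * cd g - 1) / cc g.
  by rewrite -(SL2_mxdet g); field.
rewrite [LHS]/= dE bE; set D := sqmod _ + _ in D0 *.
have DC0 : D%:C != 0 by rewrite fmorph_eq0 gt_eqF.
(* Here d = conj a enters: the conjugate of d / c is a / conj c. *)
have rE : (h3r P)%:C ^+ 2 = D%:C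
    - (h3z P + cd g / cc g) * (conjc (h3z P) + ca g / conjc (cc g)).
  rewrite /D opprK rmorphD /= sqmodE rmorphXn /= rmorphD /= rmorphM /= conjc_inv.
  by rewrite -ad conjcK; ring.
have nE := sqmodE (cc g).
move: (sqmod _) D n0 nE D0 DC0 rE {dQ dE k0} => n D n0 nE D0 DC0 rE.
rewrite !(conjcM, conjcD, conjcN).
have -> : conjc (cc g)^-1 = (conjc (cc g))^-1 := conjc_inv _.
have -> : conjc (n^-1 / D)%:C = (n^-1 / D)%:C := conjc_real _.
have tE : (n^-1 / D)%:C = (cc g * conjc (cc g))^-1 / D%:C.
  by rewrite (rmorphM (real_complex R)) !fmorphV /= nE.
have -> : ((n^-1 / D * h3r P) ^+ 2)%:C = (n^-1 / D)%:C ^+ 2 * (h3r P)%:C ^+ 2.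
  by rewrite -!rmorphXn -rmorphM -exprMn.
have -> : n * (n^-1 ^+ 2 / D) = n^-1 / D by field; rewrite n0 gt_eqF.
rewrite tE rE -ad conjcK.
by field; rewrite DC0 c0 cj0.
Qed.

Lemma Amap_reflection (R : realType) (g : SL2 R) (P : H3 R) :
  cc g != 0 -> Sigma g = ISO g ->
  h3z (Amap g P) = - (conjc (cc g) / cc g) * conjc (h3z P) /\
  h3r (Amap g P) = h3r P.
Proof.
move=> c0 hg; have k0 : 0 < (sqmod (cc g))^-1 by rewrite invr_gt0 sqmod_gt0.
rewrite /Amap /sigma hg ISO_hemisphere // /comp (hyp_reflection_hemisphere _ k0).
by apply: act_inversion => //; apply: Sigma_ISO_conjc.
Qed.

(** * The vectors conj c, i conj c, j and the plane W *)

Lemma conjcRI (R : realType) (z : R[i]) :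
  (complex.Re (conjc z) = complex.Re z) * (complex.Im (conjc z) = - complex.Im z).
Proof. by case: z. Qed.

Lemma mulIRI (R : realType) (z : R[i]) :
  (complex.Re ((0 +i* 1) * z) = - complex.Im z)
  * (complex.Im ((0 +i* 1) * z) = complex.Re z).
Proof. by case: z => x y; split; rewrite /=; ring. Qed.

Lemma cbarE (R : realType) (g : SL2 R) :
  (cbar g 0 0 = complex.Re (cc g)) * (cbar g 0 1 = - complex.Im (cc g))
  * (cbar g 0 (inord 2) = 0).
Proof. by rewrite /cbar !zrjE !conjcRI. Qed.

Lemma icbarE (R : realType) (g : SL2 R) :
  (icbar g 0 0 = complex.Im (cc g)) * (icbar g 0 1 = complex.Re (cc g))
  * (icbar g 0 (inord 2) = 0).
Proof. by rewrite /icbar !zrjE !mulIRI !conjcRI opprK. Qed.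

Lemma jvecE (R : realType) :
  (jvec R 0 0 = 0) * (jvec R 0 1 = 0) * (jvec R 0 (inord 2) = 1).
Proof. by rewrite /jvec !zrjE. Qed.

Lemma dotC (R : realType) (u v : 'rV[R]_3) : dot u v = dot v u.
Proof. by rewrite !dotE; ring. Qed.

Lemma dot0r (R : realType) (v : 'rV[R]_3) : dot v 0 = 0.
Proof. by rewrite dotE !mxE; ring. Qed.

Lemma dotZr (R : realType) a (u v : 'rV[R]_3) : dot u (a *: v) = a * dot u v.
Proof. by rewrite !dotE !mxE; ring. Qed.

Lemma dotDr (R : realType) (u v w : 'rV[R]_3) : dot u (v + w) = dot u v + dot u w.
Proof. by rewrite !dotE !mxE; ring. Qed.

Lemma WplaneP (R : realType) (g : SL2 R) (w : 'rV[R]_3) :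
  reflect (exists a b, w = a *: icbar g + b *: jvec R) (w \in Wplane g).
Proof.
rewrite /Wplane span_cons span_seq1; apply: (iffP memv_addP).
  by move=> [u /vlineP[a ->]] [v /vlineP[b ->]] ->; exists a, b.
move=> [a [b ->]]; exists (a *: icbar g); first by rewrite memvZ ?memv_line.
by exists (b *: jvec R); rewrite ?memvZ ?memv_line.
Qed.

Lemma orth_WplaneE (R : realType) (g : SL2 R) (v : 'rV[R]_3) :
  orth v (Wplane g) <-> dot v (icbar g) = 0 /\ dot v (jvec R) = 0.
Proof.
split=> [o | [oi oj] w /WplaneP[a [b ->]]]; last first.
  by rewrite dotDr !dotZr oi oj !mulr0 addr0.
by split; apply: o; rewrite memv_span // !inE eqxx ?orbT.
Qed.

Lemma dot_cbar (R : realType) (g : SL2 R) :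
  [/\ dot (cbar g) (cbar g) = sqmod (cc g), dot (icbar g) (icbar g) = sqmod (cc g),
      dot (cbar g) (icbar g) = 0, dot (cbar g) (jvec R) = 0
    & dot (icbar g) (jvec R) = 0].
Proof.
by split; rewrite dotE ?cbarE ?icbarE ?jvecE /sqmod; ring.
Qed.

Lemma cbar_orth (R : realType) (g : SL2 R) : orth (cbar g) (Wplane g).
Proof. by apply/orth_WplaneE; have [] := dot_cbar g. Qed.

Lemma orth_Wplane_line (R : realType) (g : SL2 R) (v : 'rV[R]_3) :
  cc g != 0 -> orth v (Wplane g) -> exists a, v = a *: cbar g.
Proof.
rewrite -sqmod_gt0 => n0 /orth_WplaneE[].
rewrite !dotE !icbarE !jvecE !(mulr0, addr0, add0r, mulr1) => oi oj.
have {}oi : v 0 0 * complex.Im (cc g) = - (v 0 1 * complex.Re (cc g)).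
  by apply/eqP; rewrite -addr_eq0 oi.
(* The coefficient of the orthogonal projection of v to the line of [cbar g]. *)
exists (dot v (cbar g) / sqmod (cc g)).
have n0' : complex.Re (cc g) ^+ 2 + complex.Im (cc g) ^+ 2 != 0 by rewrite gt_eqF.
apply: row3P; rewrite dotE mxE !cbarE /sqmod oj; last by ring.
- apply: (mulIf n0'); rewrite mulrAC divfK //.
  transitivity (v 0 0 * complex.Re (cc g) ^+ 2
    + complex.Im (cc g) * (v 0 0 * complex.Im (cc g))); first by ring.
  by rewrite oi; ring.
- apply: (mulIf n0'); rewrite mulrAC divfK //.
  transitivity (v 0 1 * complex.Im (cc g) ^+ 2
    + complex.Re (cc g) * (v 0 1 * complex.Re (cc g))); first by ring.
  by rewrite -[v 0 1 * complex.Re _]opprK -oi; ring.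
Qed.

(** If v were a combination of X, pairing that combination with v would give [dot v v = 0]. *)
Lemma orthogonal_free (R : realType) (X : seq 'rV[R]_3) (v : 'rV[R]_3) :
  dot v v != 0 -> {in X, forall w, dot v w = 0} -> free X -> free (v :: X).
Proof.
move=> v0 vX fX; rewrite free_cons fX andbT; apply/negP => vin.
have vE := coord_span (X := in_tuple X) vin; case/eqP: v0; rewrite {2}vE.
elim/big_ind: _ => [|x y hx hy|i _]; first exact: dot0r.
- by rewrite dotDr hx hy addr0.
- by rewrite dotZr vX ?mulr0 // mem_nth.
Qed.

Lemma free_icbar_jvec (R : realType) (g : SL2 R) :
  cc g != 0 -> free [:: icbar g; jvec R].
Proof.
rewrite -sqmod_gt0 => n0; have [_ ii _ _ ij] := dot_cbar g.
apply: orthogonal_free; first by rewrite ii gt_eqF.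
  by move=> w; rewrite inE => /eqP ->.
rewrite seq1_free; apply/eqP => j0.
by have := (jvecE R).2; rewrite j0 mxE => /eqP; rewrite eq_sym oner_eq0.
Qed.

Lemma basis_cbar (R : realType) (g : SL2 R) :
  cc g != 0 -> basis_of fullv [:: cbar g; icbar g; jvec R].
Proof.
move=> c0; rewrite basisEfree subvf dimvf dim_matrix /= andbT.
have [cc1 _ ci cj _] := dot_cbar g.
apply: orthogonal_free; last exact: free_icbar_jvec.
  by rewrite cc1 sqmod_eq0.
by move=> w; rewrite !inE => /orP[]/eqP ->.
Qed.

(** * Euclidean reflections of R^3 *)

Definition reflect_along (R : realType) (v u : 'rV[R]_3) : 'rV[R]_3 :=
  u - (2 * dot v u / dot v v) *: v.

Lemma reflect_along_linear (R : realType) (v : 'rV[R]_3) : linear (reflect_along v).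
Proof.
move=> a x y; apply/rowP => i; rewrite /reflect_along dotDr dotZr !mxE; ring.
Qed.

HB.instance Definition _ (R : realType) (v : 'rV[R]_3) :=
  GRing.isLinear.Build R 'rV[R]_3 'rV[R]_3 *:%R (reflect_along v)
    (reflect_along_linear v).

Lemma reflect_along_orth (R : realType) (v u : 'rV[R]_3) :
  dot v u = 0 -> reflect_along v u = u.
Proof. by rewrite /reflect_along => ->; rewrite mulr0 mul0r scale0r subr0. Qed.

Lemma reflect_along_self (R : realType) (v : 'rV[R]_3) :
  dot v v != 0 -> reflect_along v v = - v.
Proof.
by move=> v0; rewrite /reflect_along mulfK // scaler_nat opprD addrA subrr add0r.
Qed.

Lemma eigenvectorP (R : realType) (L : 'End('rV[R]_3)) (v : 'rV[R]_3) (a : R) :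
  v != 0 -> L v = a *: v -> is_eigenvector L v.
Proof.
move=> v0 e; split=> //; exists a; rewrite /passmx.leigenspace memv_ker.
by rewrite !lfun_simp e subrr.
Qed.

(** In C the reflection along a unit vector u is z -> -u^2 conj z; for u = conj c / |c| one has u^2
    = conj c / c. *)
Lemma reflect_along_zrj (R : realType) (c z : R[i]) (r : R) : c != 0 ->
  reflect_along (zrj (conjc c) 0) (zrj z r) = zrj (- (conjc c / c) * conjc z) r.
Proof.
rewrite -sqmod_gt0 => n0; rewrite /reflect_along !dot_zrj.
case: c z n0 => p q [x y]; rewrite /sqmod /= => n0.
rewrite (_ : p * p + - q * - q + 0 * 0 = p ^+ 2 + q ^+ 2); last by ring.
apply: row3P; rewrite !mxE /= ?inordK //=; last by ring.
all: by field; rewrite gt_eqF.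
Qed.

(** * The angle between the two planes *)

(** The Cauchy-Schwarz bound puts the quotient in [-1, 1], where [cos] inverts [acos]. *)
Lemma cos_vangle (R : realType) (u v : 'rV[R]_3) :
  dot u v ^+ 2 <= dot u u * dot v v ->
  cos (vangle u v) = dot u v / (Num.sqrt (dot u u) * Num.sqrt (dot v v)).
Proof.
have ge0 (w : 'rV[R]_3) : 0 <= dot w w by rewrite dotE !addr_ge0 // -expr2 sqr_ge0.
move=> CS; apply: acosK; rewrite in_itv /= -ler_norml -(expr_le1 (n := 2)) //.
rewrite real_normK ?num_real // expr_div_n exprMn !sqr_sqrtr //.
(* If one vector vanishes, the quotient is 0 by the convention for the inverse of 0. *)
have [->|n0] := eqVneq (dot u u * dot v v) 0; first by rewrite invr0 mulr0.
by rewrite ler_pdivrMr ?mul1r // lt0r n0 mulr_ge0.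
Qed.

(** With q = c / c1, the scalar product is Re (c conj c1) = |c1|^2 Re q, and Re q = |q| cos
    theta. *)
Lemma cbar_dot_sqr (R : realType) (g g1 : SL2 R) (theta : R) :
  cc g != 0 -> cc g1 != 0 -> is_arg (cc g / cc g1) theta ->
  dot (cbar g) (cbar g1) ^+ 2 = sqmod (cc g) * sqmod (cc g1) * cos theta ^+ 2.
Proof.
move=> c0 c10 /(congr1 (fun z => complex.Re z ^+ 2)).
rewrite ReZ exprMn sqr_sqrtr ?sqmod_ge0 // => e.
have cE : cc g = (cc g / cc g1) * cc g1 by rewrite divfK.
move: (cc g / cc g1) cE e => q cE e.
have dE : dot (cbar g) (cbar g1) = complex.Re q * sqmod (cc g1).
  by rewrite dotE !cbarE cE; case: q (cc g1) {cE e} => x y [u v]; rewrite /sqmod /=; ring.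
by rewrite dE exprMn e cE sqmodM /=; ring.
Qed.

(** The normals are known only up to nonzero real factors; squaring the cosine removes the signs of
    these factors. *)
Lemma plane_angle_cos (R : realType) (g g1 : SL2 R) (phi theta : R) :
  cc g != 0 -> cc g1 != 0 -> is_plane_angle (Wplane g) (Wplane g1) phi ->
  is_arg (cc g / cc g1) theta -> cos phi ^+ 2 = cos theta ^+ 2.
Proof.
move=> c0 c10 [n [n' [n0 n'0 on on' ->]]] arg.
have [a nE] := orth_Wplane_line c0 on; have [b n'E] := orth_Wplane_line c10 on'.
have {}n0 : a != 0 by apply: contra n0 => /eqP a0; rewrite nE a0 scale0r.
have {}n'0 : b != 0 by apply: contra n'0 => /eqP b0; rewrite n'E b0 scale0r.
have [cg _ _ _ _] := dot_cbar g; have [cg1 _ _ _ _] := dot_cbar g1.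
have e := cbar_dot_sqr c0 c10 arg.
have dE : dot n n' ^+ 2 = dot n n * dot n' n' * cos theta ^+ 2.
  rewrite nE n'E !dotZr ![dot (_ *: _) _]dotC !dotZr cg cg1 !exprMn.
  by rewrite [dot (cbar g1) _]dotC e; ring.
have nn0 : 0 < dot n n.
  by rewrite nE dotZr dotC dotZr cg mulrA -expr2 mulr_gt0 ?exprn_even_gt0 ?sqmod_gt0.
have n'n'0 : 0 < dot n' n'.
  by rewrite n'E dotZr dotC dotZr cg1 mulrA -expr2 mulr_gt0 ?exprn_even_gt0 ?sqmod_gt0.
rewrite cos_vangle; last first.
  (* Cauchy-Schwarz for the normals follows from [dE] and cos^2 theta <= 1. *)
  by rewrite dE ler_piMr ?mulr_ge0 ?(ltW nn0) ?(ltW n'n'0) // cos2sin2 gerBl sqr_ge0.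
rewrite expr_div_n exprMn !sqr_sqrtr ?(ltW nn0) ?(ltW n'n'0) // dE mulrAC divff ?mul1r //.
by rewrite mulf_neq0 ?lt0r_neq0.
Qed.

Theorem lemma4p3 (R : realType) (g g1 : SL2 R)
    (gj : act g (jpt R) <> jpt R) (c0 : cc g != 0)
    (hg : Sigma g = ISO g)
    (g1j : act g1 (jpt R) <> jpt R) (c10 : cc g1 != 0)
    (hg1 : Sigma g1 = ISO g1) :
  let B := [:: cbar g; icbar g; jvec R] in
  (exists A : 'End('rV[R]_3),
    [/\ forall P : H3 R, A (toR3 P) = toR3 (Amap g P),
        basis_of fullv B,
        forall v, v \in B -> is_eigenvector A v,
        is_plane_reflection (Wplane g) A
      & orth (cbar g) (Wplane g)]) /\
  ((exists phi : R, is_plane_angle (Wplane g) (Wplane g1) phi) /\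
   (forall phi theta : R, is_plane_angle (Wplane g) (Wplane g1) phi ->
      is_arg (cc g / cc g1) theta -> eq_angle phi theta)).
Proof.
have n0 : sqmod (cc g) != 0 by rewrite sqmod_eq0.
have [ccE iiE ciE cjE _] := dot_cbar g.
have cbar_neq0 (h : SL2 R) : cc h != 0 -> cbar h != 0.
  move=> h0; apply: contraNneq h0 => e; rewrite -sqmod_eq0.
  by have [<- _ _ _ _] := dot_cbar h; rewrite e dot0r.
split; last first.
  split; last first.
    move=> phi theta ang arg.
    exact: eq_angle_of_sqr_cos (plane_angle_cos c0 c10 ang arg).
  exists (vangle (cbar g) (cbar g1)), (cbar g), (cbar g1).
  by split; rewrite ?cbar_neq0 //; exact: cbar_orth.
have AE := lfunE (reflect_along (cbar g)).
have Acbar : linfun (reflect_along (cbar g)) (cbar g) = - cbar g.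
  by rewrite AE /= reflect_along_self // ccE.
exists (linfun (reflect_along (cbar g))); split.
- move=> P; have [zE rE] := Amap_reflection P c0 hg.
  by rewrite AE /= /toR3 zE rE reflect_along_zrj.
- exact: basis_cbar.
- move=> v; rewrite !inE => /or3P[]/eqP ->.
  + by apply: (eigenvectorP (a := -1)); rewrite ?cbar_neq0 // scaleN1r.
  + apply: (eigenvectorP (a := 1)); last by rewrite AE /= reflect_along_orth ?scale1r.
    by apply: contraNneq n0 => i0; rewrite -iiE i0 dot0r.
  + apply: (eigenvectorP (a := 1)); last by rewrite AE /= reflect_along_orth ?scale1r.
    apply/eqP => j0.
    by have := (jvecE R).2; rewrite j0 mxE => /eqP; rewrite eq_sym oner_eq0.
- split.
  (* [free] is by definition the equality of the dimension of the span with the length of the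
     list. *)
  + by apply/eqP; exact: free_icbar_jvec.
  + by move=> w wW; rewrite AE /= reflect_along_orth //; apply: cbar_orth.
  (* The orthogonal complement of W is the line of conj c, so its generator decides. *)
  + by move=> v /(orth_Wplane_line c0)[a ->]; rewrite linearZ /= Acbar scalerN.
- exact: cbar_orth.
Qed.
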